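(* Fix $2\le n<\infty$. For $k\ge1$ define $\mathcal{W}(k):=\mathcal{W}_{(n-1)k+1}$ and $\mathcal{S}(k):=\{\omega'_z: z\in\mathcal{W}(k)\}$. (i) If $k\prec l$ then $\mathcal{S}(k)\subset\mathcal{S}(l)$, and $\{(\mathcal{S}(k),\subset):k\in\mathbb{N}\}$ is an inductive system over $(\mathbb{N},\prec)$ with respect to these inclusions. (ii) When $k\prec l$, put $m=(n-1)k+1$ and define the map $\psi_{l,k}:\mathcal{W}(k)\to\mathcal{W}(l)$ by $\psi_{l,k}(z):=\hat z$, where $$\hat z:=\sum_{r=0}^{l/k-1}\sum_{i=1}^{m-1}z_m^rz_i\,e_{(m-1)r+i}+z_m^{l/k}\,e_{(n-1)l+1}$$ and $\{e_i\}$ is the standard basis of $\mathbb{C}^{(n-1)l+1}$. Then $\{(\mathcal{W}(k),\psi_{l,k}):k,l\in\mathbb{N}\}$ is an inductive system over $(\mathbb{N},\prec)$. (iii) The state parametrizations $$\Phi_k:\mathcal{W}(k)\ni z\longmapsto\omega'_z\in\mathcal{S}(k)\qquad(k\ge1)$$ give an isomorphism $\{\Phi_k:k\ge1\}$ between the inductive systems in (ii) and (i) (that is, each $\Phi_k$ is a bijection, and for $k\prec l$ and $z\in\mathcal{W}(k)$ one has $\Phi_l(\psi_{l,k}(z))=\Phi_k(z)$).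
   Context: For $2\le n<\infty$, $\mathcal{O}_n$ denotes the Cuntz algebra: the universal unital C$^*$-algebra generated by $s_1,\ldots,s_n$ with $s_i^*s_j=\delta_{ij}I$ and $\sum_{i=1}^n s_is_i^*=I$. $\mathcal{W}_m:=\{(w_1,\ldots,w_m)\in\mathbb{C}^m:\|w\|=1,\ |w_m|<1\}$. Convention: zeroth powers are $1$ (or $I$). For $m=(n-1)k+1$ with $k\ge1$ and $z\in\mathcal{W}_m$, $\omega'_z$ denotes the geometric progression state of order $k$ by $z$: the unique (and pure) state on $\mathcal{O}_n$ with $\omega'_z(s_n^rs_i)=\overline{z_{(n-1)r+i}}$ for all $r=0,\ldots,k-1$, $i=1,\ldots,n-1$, and $\omega'_z(s_n^k)=\overline{z_m}$. $\mathbb{N}=\{1,2,\ldots\}$, and $k\prec l$ (equivalently $l\succ k$) means that $k$ is a divisor of $l$; $(\mathbb{N},\prec)$ is a directed set. A (set-theoretical) inductive system over a directed set $(D,\le)$ is a family of sets $A_d$ ($d\in D$) with maps $\varphi_{e,d}:A_d\to A_e$ ($d\le e$) satisfying $\varphi_{g,e}\circ\varphi_{e,d}=\varphi_{g,d}$ for $d\le e\le g$ and $\varphi_{d,d}=\mathrm{id}_{A_d}$. *)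

(* Defs.v *)
From HB Require Import structures.
From mathcomp Require Import all_boot all_order all_algebra.
From mathcomp Require Import complex.
From mathcomp Require Import all_classical all_reals.

Set Implicit Arguments.
Unset Strict Implicit.
Unset Printing Implicit Defensive.

Import Order.TTheory GRing.Theory Num.Theory.
Import ComplexField.Normc.

Local Open Scope classical_set_scope.
Local Open Scope ring_scope.

(* Unital complex C*-algebras. The norm is a separate field because
   completeNormedModType and algType have no common extension in the hierarchy
   (a join of SemiNormedZmodule and PzSemiRing would have to sit below
   numDomainType). Nonnegativity of the norm follows from the axioms. *)
HB.mixin Record isCStarAlgebra (R : realType) A & GRing.Algebra R[i] A := {
  star : A -> A;
  cstar_norm : A -> R;
  starK : involutive star;
  starD : forall x y : A, star (x + y) = star x + star y;
  starZ : forall (a : R[i]) (x : A), star (a *: x) = a^* *: star x;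
  starM : forall x y : A, star (x * y) = star y * star x;
  cstar_norm0_eq0 : forall x : A, cstar_norm x = 0 -> x = 0;
  cstar_normD : forall x y : A,
    cstar_norm (x + y) <= cstar_norm x + cstar_norm y;
  cstar_normZ : forall (a : R[i]) (x : A),
    cstar_norm (a *: x) = normc a * cstar_norm x;
  cstar_normM : forall x y : A,
    cstar_norm (x * y) <= cstar_norm x * cstar_norm y;
  cstar_identity : forall x : A, cstar_norm (star x * x) = cstar_norm x ^+ 2;
  cstar_complete : forall u : nat -> A,
    (forall e : R, 0 < e -> exists N : nat, forall p q : nat,
       (N <= p)%N -> (N <= q)%N -> cstar_norm (u p - u q) < e) ->
    exists x : A, forall e : R, 0 < e -> exists N : nat, forall p : nat,
       (N <= p)%N -> cstar_norm (u p - x) < e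
}.

#[short(type="cstarAlgType")]
HB.structure Definition CStarAlgebra (R : realType) :=
  { A of isCStarAlgebra R A & GRing.Algebra R[i] A }.

Section CuntzAlgebra.
Variable R : realType.

Record cstar_subalgebra (A : cstarAlgType R) (S : set A) : Prop := {
  cstar_sub1 : S 1;
  cstar_subZD : forall (a : R[i]) x y, S x -> S y -> S (a *: x + y);
  cstar_subM : forall x y, S x -> S y -> S (x * y);
  cstar_subV : forall x, S x -> S (star x);
  cstar_sub_closed : forall x : A,
    (forall e : R, 0 < e -> exists y : A, S y /\ cstar_norm (x - y) < e) -> S x
}.

Definition cuntz_relations (A : cstarAlgType R) n (s : n.-tuple A) : Prop :=
  (forall i j : 'I_n, star (tnth s i) * tnth s j = (i == j)%:R) /\
  \sum_(i < n) tnth s i * star (tnth s i) = 1.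

(* (A, s) is (a model of) the Cuntz algebra with its canonical generators.
   Uniqueness of the morphism f follows from generation. *)
Record is_cuntz_algebra (A : cstarAlgType R) n (s : n.-tuple A) : Prop := {
  cuntz_rel : cuntz_relations s;
  cuntz_generated : forall S : set A, cstar_subalgebra S ->
    (forall i, S (tnth s i)) -> S = setT;
  cuntz_universal : forall (B : cstarAlgType R) (t : n.-tuple B),
    cuntz_relations t ->
    exists f : {lrmorphism A -> B},
      (forall x, f (star x) = star (f x)) /\
      (forall i, f (tnth s i) = tnth t i)
}.

Record is_state (A : cstarAlgType R) (w : A -> R[i]) : Prop := {
  state_linear : scalar w;
  state_ge0 : forall x, 0 <= w (star x * x);
  state1 : w 1 = 1
}.

(* 1-based access: [gen s i] is s_i, [coord z j] is z_j, [basis m j] is e_j *)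
Definition gen (A : cstarAlgType R) n (s : n.-tuple A) (i : nat) : A :=
  s`_(i.-1).

Definition coord m (z : 'rV[R[i]]_m.+1) (j : nat) : R[i] := z 0 (inord j.-1).

Definition basis m (j : nat) : 'rV[R[i]]_m.+1 := delta_mx 0 (inord j.-1).

Definition euclidean_norm m (z : 'rV[R[i]]_m) : R[i] :=
  sqrtC (\sum_(i < m) `|z 0 i| ^+ 2).

(* [Wset m] is the set W_(m+1): the last coordinate of w has index m+1. *)
Definition Wset m : set 'rV[R[i]]_m.+1 :=
  [set w | euclidean_norm w = 1 /\ `|coord w m.+1| < 1].

Definition W n k : set 'rV[R[i]]_(n.-1 * k).+1 := @Wset (n.-1 * k)%N.

Definition is_geometric_state (A : cstarAlgType R) n (s : n.-tuple A) k
    (z : 'rV[R[i]]_(n.-1 * k).+1) (w : A -> R[i]) : Prop :=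
  [/\ is_state w,
      forall r i, (r < k)%N -> (1 <= i <= n.-1)%N ->
        w (gen s n ^+ r * gen s i) = (coord z (n.-1 * r + i)%N)^*
    & w (gen s n ^+ k) = (coord z (n.-1 * k).+1%N)^* ].

(* The state omega'_z is the unique state satisfying [is_geometric_state]. *)
Definition geometric_state (A : cstarAlgType R) n (s : n.-tuple A) k
    (z : 'rV[R[i]]_(n.-1 * k).+1) : A -> R[i] :=
  xget (fun=> 0) [set w | is_geometric_state s z w].

Definition Sset (A : cstarAlgType R) n (s : n.-tuple A) k : set (A -> R[i]) :=
  [set geometric_state s z | z in @W n k].

(* The vector \hat z; only meaningful when k divides l. *)
Definition psi n l k (z : 'rV[R[i]]_(n.-1 * k).+1) :
    'rV[R[i]]_(n.-1 * l).+1 :=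
  let m := (n.-1 * k).+1%N in
  \sum_(0 <= r < l %/ k) \sum_(1 <= i < m)
     (coord z m ^+ r * coord z i) *: basis (n.-1 * l)%N (m.-1 * r + i)%N
  + coord z m ^+ (l %/ k) *: basis (n.-1 * l)%N (n.-1 * l).+1%N.

End CuntzAlgebra.

Section InductiveSystem.
Variables (I : Type) (D : set I) (le : I -> I -> Prop).

Record directed_set : Prop := {
  directed_neq0 : D !=set0;
  directed_refl : forall d, D d -> le d d;
  directed_trans : forall d e g, D d -> D e -> D g ->
    le d e -> le e g -> le d g;
  directed_ub : forall d e, D d -> D e ->
    exists g, [/\ D g, le d g & le e g]
}.

(* The transition map A_d -> A_e is [phi e d]; its values are meaningful only
   for d, e in D with d <= e, and on A_d. *)
Record inductive_system (T : I -> Type) (A : forall d, set (T d))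
    (phi : forall e d, T d -> T e) : Prop := {
  inductive_directed : directed_set;
  inductive_fun : forall d e, D d -> D e -> le d e ->
    {homo phi e d : x / A d x >-> A e x};
  inductive_comp : forall d e g, D d -> D e -> D g -> le d e -> le e g ->
    forall x, A d x -> phi g e (phi e d x) = phi g d x;
  inductive_id : forall d, D d -> forall x, A d x -> phi d d x = x
}.

Record inductive_isomorphism
    (T : I -> Type) (A : forall d, set (T d)) (phi : forall e d, T d -> T e)
    (T' : I -> Type) (A' : forall d, set (T' d))
    (phi' : forall e d, T' d -> T' e) (F : forall d, T d -> T' d) : Prop := {
  inductive_iso_bij : forall d, D d -> set_bij (A d) (A' d) (F d);
  inductive_iso_comm : forall d e, D d -> D e -> le d e ->
    forall x, A d x -> F e (phi e d x) = phi' e d (F d x)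
}.

End InductiveSystem.

Definition posnat : set nat := [set k | (0 < k)%N].

Definition divides (k l : nat) : Prop := (k %| l)%N.

(* Main.v *)
(* Let t_1, ..., t_m be the isometries s_n^r s_i (r < k, i < n) and s_n^k. They
   have orthogonal ranges, so T = sum_j z_j t_j is an isometry when |z| = 1, and a
   state w is a geometric progression state by z iff w((T - 1)^*(T - 1)) = 0, that
   is, iff T fixes the GNS vector of w.

   Existence: a Hahn-Banach type separation of -1 from the cone generated by the
   squares x^*x and -(T - 1)^*(T - 1); the two are disjoint because T has a
   wandering vector U = t_m - conj(z_m) T (here |z_m| < 1 is used) and because
   x^*x is never a negative scalar.

   Uniqueness: the difference D of two such states satisfies
   D(t_j x) = conj(z_j) D(x) and D(T^* x) = D(x). As |z_m| < 1 this forces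
   D(s_n^c) = 0 for c < k, then D = 0 on all words s_J s_K^*, and D is bounded.

   The vector \hat z satisfies T_{\hat z} - 1 = Y (T_z - 1) for some Y, so the state
   by z is also the state by \hat z. The remaining assertions follow from this and
   from the injectivity of z |-> omega'_z. *)

From HB Require Import structures.
Require Import Defs.
From mathcomp Require Import all_boot all_order all_algebra.
From mathcomp Require Import complex.
From mathcomp Require Import all_classical all_reals.
From mathcomp Require Import zify ring lra.

Set Implicit Arguments.
Unset Strict Implicit.
Unset Printing Implicit Defensive.

Import Order.TTheory GRing.Theory Num.Theory.
Import ComplexField.Normc.

Local Open Scope classical_set_scope.
Local Open Scope ring_scope.

Local Notation "r %:C" := (real_complex _ r) : ring_scope.
Local Notation "'i" := ('i%C) : ring_scope.

(** * Norm, square roots and squares in a C*-algebra *)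

Section CStarBasics.
Variables (R : realType) (A : cstarAlgType R).
Implicit Types (x y h : A) (r : R).
Local Notation norm := (@cstar_norm R A).

Lemma conj_real_complex r : (r%:C : R[i])^* = r%:C.
Proof. by have /= := conjc_real r. Qed.

Lemma conj_i : ('i : R[i])^* = - 'i.
Proof. by apply/eqP; rewrite eq_complex /= oppr0 !eqxx. Qed.

Lemma normc_real_complex r : normc (r%:C) = `|r|.
Proof. by rewrite /normc /= expr0n /= addr0 sqrtr_sqr. Qed.

Lemma star0 : star (0 : A) = 0.
Proof. by apply: (addrI (star 0)); rewrite -starD !addr0. Qed.

Lemma starN x : star (- x) = - star x.
Proof. by apply: (addrI (star x)); rewrite -starD !subrr star0. Qed.

Lemma starB x y : star (x - y) = star x - star y.
Proof. by rewrite starD starN. Qed.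

Lemma star1 : star (1 : A) = 1.
Proof. by rewrite -[LHS]mulr1 -[1 in X in _ * X]starK -starM mulr1 starK. Qed.

Lemma starX x n : star (x ^+ n) = star x ^+ n.
Proof. by elim: n => [|n IH]; rewrite ?star1// exprS starM IH -exprSr. Qed.

Lemma star_sum (I : Type) (s : seq I) (P : pred I) (F : I -> A) :
  star (\sum_(i <- s | P i) F i) = \sum_(i <- s | P i) star (F i).
Proof. exact: (big_morph _ starD star0). Qed.

Lemma cnorm0 : norm 0 = 0.
Proof. by rewrite -(scale0r (0 : A)) cstar_normZ normc0 mul0r. Qed.

Lemma cnormZr r x : norm (r%:C *: x) = `|r| * norm x.
Proof. by rewrite cstar_normZ normc_real_complex. Qed.

Lemma cnormN x : norm (- x) = norm x.
Proof. by rewrite -scaleN1r cstar_normZ normcN normc1 mul1r. Qed.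

Lemma cnorm_ge0 x : 0 <= norm x.
Proof.
have := cstar_normD x (- x); rewrite subrr cnorm0 cnormN; lra.
Qed.

Lemma cnormB x y : norm (x - y) <= norm x + norm y.
Proof. by rewrite -(cnormN y) cstar_normD. Qed.

Lemma cnorm_distC x y : norm (x - y) = norm (y - x).
Proof. by rewrite -cnormN opprB. Qed.

Lemma cnorm_star x : norm (star x) = norm x.
Proof.
have le y : norm y <= norm (star y).
  have := cnorm_ge0 y; rewrite le_eqVlt => /predU1P[<-|y0]; first exact: cnorm_ge0.
  by rewrite -(ler_pM2r y0) -expr2 -cstar_identity cstar_normM.
by apply/eqP; rewrite eq_le le -{2}(starK x) le.
Qed.

Lemma cnorm1 : norm 1 = 1.
Proof.
have n0 : norm 1 != 0.
  by apply/eqP => /cstar_norm0_eq0/eqP; rewrite oner_eq0.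
by apply: (mulfI n0); rewrite mulr1 -expr2 -cstar_identity star1 mulr1.
Qed.

(** Replaces passages to the limit in the norm estimates below. [K] may have either sign, hence the
    absolute value in [q]. *)
Lemma small_le0 (v K : R) : (forall e, 0 < e -> v <= K * e) -> v <= 0.
Proof.
move=> small; rewrite leNgt; apply/negP => v0; set q := v / (`|K| + 1).
have vE : v = q * (`|K| + 1) by rewrite divfK// gt_eqF// ltr_wpDl.
have q0 : 0 < q by rewrite divr_gt0// ltr_wpDl.
have := le_trans (small _ q0) (ler_wpM2r (ltW q0) (ler_norm K)).
rewrite vE; nra.
Qed.

Lemma cnorm_small_eq0 x K : (forall e, 0 < e -> norm x <= K * e) -> x = 0.
Proof.
by move=> small; apply: cstar_norm0_eq0; apply/eqP; rewrite eq_le cnorm_ge0 (small_le0 small).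
Qed.

Lemma cauchy_of_geometric (u : nat -> A) :
  (forall n, norm (u n.+1 - u n) <= 2^-1 ^+ n) ->
  forall e, 0 < e -> exists N : nat, forall p q : nat,
    (N <= p)%N -> (N <= q)%N -> norm (u p - u q) < e.
Proof.
move=> uS e e0.
have tail N d : norm (u (N + d)%N - u N) <= 2 * 2^-1 ^+ N - 2 * 2^-1 ^+ (N + d).
  elim: d => [|d IH]; first by rewrite addn0 !subrr cnorm0.
  rewrite addnS; have := cstar_normD (u (N + d).+1 - u (N + d)%N) (u (N + d)%N - u N).
  rewrite addrA subrK => /le_trans; apply.
  by have := uS (N + d)%N; rewrite exprS; lra.
have [N hN] : exists N, 4 * 2^-1 ^+ N < e.
  exists (Num.bound (4 / e)); have := upper_nthrootP (leqnn (Num.bound (4 / e))).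
  by rewrite exprVn ltr_pdivrMr// ltr_pdivrMr ?exprn_gt0// mulrC.
have pos n : 0 <= (2^-1 : R) ^+ n by rewrite exprn_ge0// invr_ge0.
exists N => p q /subnKC<- /subnKC<-.
have := cstar_normD (u (N + (p - N))%N - u N) (u N - u (N + (q - N))%N).
rewrite addrA subrK => /le_lt_trans; apply.
rewrite [X in _ + X]cnorm_distC.
have := tail N (p - N)%N; have := tail N (q - N)%N.
have := pos (N + (p - N))%N; have := pos (N + (q - N))%N; have := hN; lra.
Qed.

(* A contraction: y = (h + y^2)/2 has a solution of norm at most 1/2, and then
   (1 - y)^2 = 1 - h. *)
Lemma cstar_sqrt h : star h = h -> norm h <= 2^-1 ->
  exists b, [/\ star b = b, b * b = 1 - h &
    forall x, x * h = h * x -> x * b = b * x].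
Proof.
move=> hs hn; pose y := fix y n := if n is m.+1 then (2^-1 : R)%:C *: (h + y m * y m) else 0.
have yS n : y n.+1 = (2^-1 : R)%:C *: (h + y n * y n) by [].
have half0 : `|(2^-1 : R)| = 2^-1 by rewrite ger0_norm ?invr_ge0.
have ys n : star (y n) = y n.
  elim: n => [|n IH]; first exact: star0.
  by rewrite yS starZ starD starM hs IH conj_real_complex.
have yn n : norm (y n) <= 2^-1.
  elim: n => [|n IH]; first by rewrite cnorm0 invr_ge0.
  rewrite yS cnormZr half0.
  have := cstar_normD h (y n * y n); have := cstar_normM (y n) (y n).
  by have := cnorm_ge0 (y n); nra.
have yc x : x * h = h * x -> forall n, x * y n = y n * x.
  move=> xh; elim=> [|n IH]; first by rewrite mulr0 mul0r.
  by rewrite yS -scalerAr -scalerAl mulrDr mulrDl xh mulrA IH -mulrA IH mulrA.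
have sqB p q : norm (p * p - q * q) <= (norm p + norm q) * norm (p - q).
  have -> : p * p - q * q = p * (p - q) + (p - q) * q.
    by rewrite mulrBr mulrBl addrA subrK.
  apply: le_trans (cstar_normD _ _) _.
  by have := cstar_normM p (p - q); have := cstar_normM (p - q) q; lra.
(* On the ball of radius 1/2 squaring does not increase distances, so the factor 1/2 in the
   recursion halves each increment. *)
have yd n : norm (y n.+1 - y n) <= 2^-1 ^+ n.
  elim: n => [|n IH].
    by rewrite subr0 expr0 (le_trans (yn 1%N))// invf_le1 ?ler1n.
  rewrite exprS (yS n.+1) {2}(yS n) -scalerBr opprD addrACA subrr add0r cnormZr half0.
  rewrite ler_pM2l ?invr_gt0//; apply: le_trans (sqB _ _) _.
  have := yn n; have := yn n.+1; have := cnorm_ge0 (y n.+1 - y n); nra.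
have [b yb] := cstar_complete y (cauchy_of_geometric yd).
have bE : b = (2^-1 : R)%:C *: (h + b * b).
  apply/eqP; rewrite -subr_eq0; apply/eqP.
  apply: (@cnorm_small_eq0 _ (1 + (2^-1 + norm b))) => e e0.
  have [N hN] := yb _ e0.
  have := cstar_normD (b - y N.+1) (y N.+1 - (2^-1 : R)%:C *: (h + b * b)).
  rewrite addrA subrK => /le_trans; apply.
  rewrite {2}yS -scalerBr opprD addrACA subrr add0r cnormZr half0 cnorm_distC.
  have := hN _ (leqnSn N); have := hN _ (leqnn N); have := sqB (y N) b.
  have := yn N; have := cnorm_ge0 b; have := cnorm_ge0 (y N - b); nra.
have bs : star b = b.
  apply/eqP; rewrite -subr_eq0; apply/eqP.
  apply: (@cnorm_small_eq0 _ 2) => e e0; have [N hN] := yb _ e0.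
  have := cstar_normD (star b - y N) (y N - b); rewrite addrA subrK => /le_trans; apply.
  rewrite -{1}(ys N) -starB cnorm_star cnorm_distC.
  by have := hN _ (leqnn N); lra.
exists (1 - b); split.
- by rewrite starB star1 bs.
- have b2 : b + b = h + b * b.
    rewrite {1 2}bE -scalerDl -rmorphD/= (_ : 2^-1 + 2^-1 = 1 :> R); last by field.
    by rewrite scale1r.
  have -> : (1 - b) * (1 - b) = 1 - b + (b * b - b).
    by rewrite mulrBr mulr1 mulrBl mul1r opprB.
  have -> : b * b - b = b - h.
    by apply/eqP; rewrite subr_eq addrAC b2 addrC addKr.
  by rewrite addrA subrK.

- move=> x /yc xy; rewrite mulrBr mulrBl mulr1 mul1r; congr (_ - _).
  apply/eqP; rewrite -subr_eq0; apply/eqP.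
  apply: (@cnorm_small_eq0 _ (2 * norm x)) => e e0; have [N hN] := yb _ e0.
  have -> : x * b - b * x = (y N - b) * x - x * (y N - b).
    by rewrite mulrBl mulrBr xy opprB [RHS]addrC addrA subrK.
  apply: le_trans (cnormB _ _) _.
  have := cstar_normM (y N - b) x; have := cstar_normM x (y N - b).
  have := hN _ (leqnn N); have := cnorm_ge0 x; nra.
Qed.

(** [a] is the real part of [u = a + i b], where [b] is a square root of [1 - a^2] commuting with
    [a]. As [v u = 1] for the adjoint [v] of [u], both have norm 1, and
    [1/2 - a^2 = - (u^2 + v^2) / 4]. *)
Lemma cstar_square_norm a : star a = a -> norm a ^+ 2 <= 2^-1 ->
  norm ((2^-1 : R)%:C *: 1 - a * a) <= 2^-1.
Proof.
move=> sa na.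
have [b [sb bb cb]] : exists b, [/\ star b = b, b * b = 1 - a * a &
    forall x, x * (a * a) = a * a * x -> x * b = b * x].
  by apply: cstar_sqrt; rewrite ?starM ?sa// -{1}sa cstar_identity.
have ab : a * b = b * a by apply: cb; rewrite mulrA.
have iiN (x : A) : 'i *: ('i *: x) = - x.
  by rewrite scalerA -expr2 sqr_i scaleN1r.
pose u := a + 'i *: b; pose v := a - 'i *: b.
have su : star u = v by rewrite starD starZ sa sb conj_i scaleNr.
have vu : v * u = 1.
  rewrite mulrBl !mulrDr -!scalerAl -!scalerAr iiN -ab bb.
  by rewrite opprD opprK addrA addrK addrC subrK.
have nu : norm u = 1.
  by apply/eqP; rewrite -(@eqrXn2 _ 2) ?cnorm_ge0// -cstar_identity su vu cnorm1 expr1n.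
have nv : norm v = 1 by rewrite -su cnorm_star.
have E : (2^-1 : R)%:C *: 1 - a * a = - (4^-1 : R)%:C *: (u * u + v * v).
  have -> : u * u + v * v = (a * a - b * b) *+ 2.
    rewrite /u /v mulrBl mulrDl !mulrBr !mulrDr -!scalerAl -!scalerAr !iiN ab.
    move: (a * a) ('i *: (b * a)) (b * b) => X P Y; rewrite opprD opprK.
    by rewrite (addrACA (X + P)) (addrACA X) (addrACA P) !subrr addr0 add0r mulr2n addrACA.
  have -> : a * a - b * b = a * a *+ 2 - 1 by rewrite bb opprB addrA -mulr2n.
  rewrite -[in RHS]scaler_nat scalerA.
  have -> : - (4^-1 : R)%:C * 2 = - (2^-1 : R)%:C.
    by rewrite -(rmorph_nat (real_complex R)) -rmorphN -rmorphM -rmorphN/=; congr (_%:C); field.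
  rewrite scaleNr scalerBr opprB -scaler_nat scalerA.
  have -> : (2^-1 : R)%:C * 2 = 1.
    by rewrite -(rmorph_nat (real_complex R)) -rmorphM mulVf// pnatr_eq0.
  by rewrite scale1r.
rewrite E -rmorphN cnormZr normrN ger0_norm ?invr_ge0//.
have := cstar_normD (u * u) (v * v); have := cstar_normM u u; have := cstar_normM v v.
rewrite nu nv; lra.
Qed.

Lemma cstar_square_norm_scaled k a : 0 <= k -> star a = a -> k * norm a ^+ 2 <= 2^-1 ->
  norm ((2^-1 : R)%:C *: 1 - k%:C *: (a * a)) <= 2^-1.
Proof.
move=> k0 sa ka; have -> : k%:C *: (a * a) = (Num.sqrt k)%:C *: a * ((Num.sqrt k)%:C *: a).
  by rewrite -scalerAl -scalerAr scalerA -rmorphM -[_ * Num.sqrt k]expr2 sqr_sqrtr.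
apply: cstar_square_norm; first by rewrite starZ sa conj_real_complex.
by rewrite cnormZr exprMn real_normK ?num_real// sqr_sqrtr.
Qed.

(* If x^*x = -r, then p = xx^* satisfies p^2 = -r p, so the squares of the
   self-adjoint elements x + x^*, i(x - x^* ) and p add up, with positive weights,
   to a negative scalar. But each 1/2 - k a^2, for k small, has norm at most
   1/2, so a sum of three squares cannot be negative. *)
Lemma cstar_square_neq_neg x r : 0 < r -> star x * x <> - r%:C *: 1.
Proof.
move=> r0 xx; pose p := x * star x; pose a := x + star x; pose b := 'i *: (x - star x).
have sp : star p = p by rewrite starM starK.
have sa : star a = a by rewrite starD starK addrC.
have sb : star b = b by rewrite starZ starB starK conj_i scaleNr -scalerN opprB.
have pp : p * p = - r%:C *: p.
  by rewrite /p mulrA -(mulrA x) xx -scalerAr mulr1 -scalerAl.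
(* With [k = 1 / (2 K)], the weights [k], [k] and [2 k / r] on the three squares all meet the bound
   of [cstar_square_norm_scaled]. *)
pose K := 1 + norm a ^+ 2 + norm b ^+ 2 + 2 / r * norm p ^+ 2.
have [a0 b0 p0] : [/\ 0 <= norm a ^+ 2, 0 <= norm b ^+ 2 & 0 <= 2 / r * norm p ^+ 2].
  by rewrite !exprn_ge0 ?cnorm_ge0// mulr_ge0 ?exprn_ge0 ?cnorm_ge0// divr_ge0// ltW.
have K0 : 0 < K by rewrite /K; lra.
pose k := 2^-1 / K; have k0 : 0 < k by rewrite divr_gt0// invr_gt0.
have kK : k * K = 2^-1 by rewrite divfK// gt_eqF.
have na : norm ((2^-1 : R)%:C *: 1 - k%:C *: (a * a)) <= 2^-1.
  by apply: cstar_square_norm_scaled (ltW k0) sa _; rewrite -kK ler_pM2l// /K; lra.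
have nb : norm ((2^-1 : R)%:C *: 1 - k%:C *: (b * b)) <= 2^-1.
  by apply: cstar_square_norm_scaled (ltW k0) sb _; rewrite -kK ler_pM2l// /K; lra.
have np : norm ((2^-1 : R)%:C *: 1 - (k * (2 / r))%:C *: (p * p)) <= 2^-1.
  apply: cstar_square_norm_scaled sp _; first by rewrite (mulr_ge0 (ltW k0))// divr_ge0// ltW.
  by rewrite -kK -mulrA ler_pM2l// /K; lra.
have abE : a * a + b * b = 2 *: (p - r%:C *: 1).
  rewrite -scaleNr -xx /a /b -scalerAl -scalerAr scalerA -['i * 'i]expr2 sqr_i scaleN1r.
  rewrite !mulrDl !mulrDr !mulrN !mulNr opprK -/p.
  move: (x * x) (star x * star x) (star x * x) => X Y Z.
  by rewrite !opprD !opprK addrACA (addrACA X) (addrACA Z) !subrr add0r addr0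
    scaler_nat mulr2n addrACA.
(* The weight [2 k / r] on [p^2 = - r p] cancels the multiple of [p] coming from [a^2 + b^2]. The
   scalar left over exceeds 3/2, the bound given by the three norms. *)
have S : ((2^-1 : R)%:C *: 1 - k%:C *: (a * a)) + ((2^-1 : R)%:C *: 1 - k%:C *: (b * b)) +
    ((2^-1 : R)%:C *: 1 - (k * (2 / r))%:C *: (p * p)) = (3 / 2 + 2 * k * r)%:C *: (1 : A).
  rewrite (addrACA ((2^-1)%:C *: 1) (- (k%:C *: (a * a)))) -opprD.
  rewrite -[k%:C *: _ + k%:C *: _]scalerDr abE pp.
  rewrite !scalerBr !scalerA.
  have -> : (k * (2 / r))%:C * - r%:C = - (k%:C * 2).
    rewrite -(rmorph_nat (real_complex R)) -rmorphN -!rmorphM -rmorphN/=.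
    by congr (_%:C); field; rewrite gt_eqF.
  have cancel (X Y Z V : A) : X + (Y - Z) + (V + Z) = X + Y + V.
    by rewrite (addrC V) addrA -(addrA X) subrK.
  rewrite scaleNr opprK opprB cancel -!scalerDl.
  rewrite -(rmorph_nat (real_complex R)) -!rmorphM -!rmorphD/=.
  by congr (_%:C *: _); field.
have : norm ((3 / 2 + 2 * k * r)%:C *: (1 : A)) <= 3 / 2.
  rewrite -S; apply: le_trans (cstar_normD _ _) _.
  have := cstar_normD ((2^-1 : R)%:C *: 1 - k%:C *: (a * a))
    ((2^-1 : R)%:C *: 1 - k%:C *: (b * b)).
  lra.
have kr : 0 < k * r by rewrite mulr_gt0.
rewrite cnormZr cnorm1 mulr1 ger0_norm; lra.
Qed.

End CStarBasics.
(** * Separation of a cone from a point *)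

Section ConeSeparation.
Variables (R : realType) (V : lmodType R).
Implicit Types (x y : V) (r t : R) (C : set V).

Definition convex_cone C :=
  (forall x y, C x -> C y -> C (x + y)) /\ (forall r x, 0 <= r -> C x -> C (r *: x)).

(** Take a maximal cone by Zorn's lemma. Adjoining an element outside it captures [- e]; if this
    happened for both [x] and [- x], the cone itself would contain [- e]. *)
Lemma maximal_proper_cone (e : V) (P : set V) :
  convex_cone P -> P e -> ~ P (- e) ->
  exists C, [/\ convex_cone C, P `<=` C, ~ C (- e) & forall x, C x \/ C (- x)].
Proof.
move=> [PD PZ] Pe PNe.
(* Stability under adding elements of [P] stands in for containing [P]: the union of the empty chain
   is empty and must satisfy [F] too. *)
pose F C := [/\ convex_cone C, forall x p, C x -> P p -> C (x + p) & ~ C (- e)].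
have FP : F P by [].
have [|C [[[CD CZ] CP CNe] Cmax]] := @Zorn_bigcup V F.
  move=> G GF Gtot; split.
  - split.
      move=> x y [X GX Xx] [Y GY Yy].
      have [XY|YX] := Gtot _ _ GX GY.
        by exists Y => //; have [[+ _] _ _] := GF _ GY; apply => //; exact: XY.
      by exists X => //; have [[+ _] _ _] := GF _ GX; apply => //; exact: YX.
    by move=> r x r0 [X GX Xx]; exists X => //; have [[_ +] _ _] := GF _ GX; apply.
  - by move=> x p [X GX Xx] Pp; exists X => //; have [_ + _] := GF _ GX; apply.
  - by move=> [X GX]; have [_ _ +] := GF _ GX.
have maxE D : F D -> C `<=` D -> D `<=` C.
  move=> FD CD' x Dx; apply: contrapT => nCx; apply: (Cmax D) => //.
  by split=> // /(_ _ Dx).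
have PC : P `<=` C.
  apply: subset_trans (maxE (C `|` P) _ _); [by move=> x; right| |by move=> x; left].
  split.
  - split.
      move=> x y [Cx|Px] [Cy|Py].
      + by left; exact: CD.
      + by left; exact: CP.
      + by left; rewrite addrC; exact: CP.
      + by right; exact: PD.
    by move=> r x r0 [Cx|Px]; [left; exact: CZ|right; exact: PZ].
  - by move=> x p [Cx|Px] Pp; [left; exact: CP|right; exact: PD].
  - by case.
have C0 : C 0 by rewrite -(scale0r e); apply: CZ => //; exact: PC.
have adjoin x : ~ C x -> exists c r, [/\ C c, 0 < r & c + r *: x = - e].
  move=> nCx; pose D := [set y | exists c r, [/\ C c, 0 <= r & y = c + r *: x]].
  have CsubD : C `<=` D by move=> c Cc; exists c, 0; rewrite scale0r addr0.
  have Dx : D x by exists 0, 1; rewrite scale1r add0r.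
  have : ~ F D by move=> /maxE /(_ CsubD) /(_ _ Dx).
  apply: contra_notP => noadj; split.
  - split.
      move=> _ _ [c [r [Cc r0 ->]]] [c' [r' [Cc' r'0 ->]]].
      by exists (c + c'), (r + r'); rewrite addr_ge0// scalerDl addrACA; split=> //; exact: CD.
    move=> r _ r0 [c [r' [Cc r'0 ->]]].
    by exists (r *: c), (r * r'); rewrite mulr_ge0// scalerDr scalerA; split=> //; exact: CZ.
  - move=> _ p [c [r [Cc r0 ->]]] Pp; exists (c + p), r; rewrite addrAC.
    by split=> //; exact: CP.
  - move=> [c [r [Cc]]]; rewrite le_eqVlt => /predU1P[<-|r0] eE.
      by apply: CNe; rewrite eE scale0r addr0.
    by apply: noadj; exists c, r.
exists C; split=> // x; apply: contrapT => /not_orP[/adjoin[c [r [Cc r0 cE]]]].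
move=> /adjoin[c' [r' [Cc' r'0 c'E]]]; apply: CNe.
(* Weighting the two expressions of [- e] by [r'] and [r] eliminates [x]. *)
have -> : - e = (r + r')^-1 *: (r' *: c + r *: c').
  have -> : r' *: c + r *: c' = r' *: (c + r *: x) + r *: (c' + r' *: - x).
    by rewrite !scalerDr !scalerA scalerN addrACA (mulrC r') subrr addr0.
  rewrite cE c'E -scalerDl (addrC r') scalerA mulVf ?scale1r//.
  by rewrite gt_eqF// addr_gt0.
apply: (CZ); first by rewrite invr_ge0 addr_ge0 ?ltW.
by apply: CD; apply: CZ => //; exact: ltW.
Qed.

(** The maximal cone makes any two vectors comparable, so comparing [x] with the multiples of [e]
    cuts the real line at one point, [phi x]. Linearity follows from the uniqueness of the cut. *)
Lemma positive_functional (e : V) (P : set V) :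
  convex_cone P -> P e -> (forall x, exists t, P (t *: e - x)) -> ~ P (- e) ->
  exists phi : V -> R, [/\ scalar phi, phi e = 1 & forall x, P x -> 0 <= phi x].
Proof.
move=> coneP Pe unitP PNe.
have [C [[CD CZ] PC CNe Ctot]] := maximal_proper_cone coneP Pe PNe.
have Ce : C e by exact: PC.
have Cneg t : C (t *: e) -> 0 <= t.
  move=> Ct; rewrite leNgt; apply/negP => t0; apply: CNe.
  rewrite -scaleN1r (_ : -1 = (- t)^-1 * t); last by field; rewrite lt_eqF.
  by rewrite -scalerA; apply: CZ => //; rewrite invr_ge0 oppr_ge0 ltW.
(* The inequalities are strict because [C] need not be closed: membership at [t = a] is left
   open. *)
pose cut x a := (forall t, t < a -> C (x - t *: e)) /\ (forall t, a < t -> C (t *: e - x)).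
have cut_le x a b : cut x a -> cut x b -> a <= b.
  move=> [xa _] [_ xb]; rewrite leNgt; apply/negP => ba.
  have /Cneg : C (((b + (a - b) / 3) - (b + (a - b) / 3 * 2)) *: e).
    rewrite scalerBl -(subrK x (_ *: e)) -addrA.
    by apply: CD; [apply: xb; lra|apply: xa; lra].
  lra.
have cut_ex x : exists a, cut x a.
  pose E := [set t | C (x - t *: e)].
  have [s Ps] := unitP x; have [s' Ps'] := unitP (- x).
  have E0 : E !=set0.
    by exists (- s'); rewrite /E/= scaleNr opprK addrC; move: Ps'; rewrite opprK => /PC.
  have Eub t : E t -> t <= s.
    move=> Et; rewrite -subr_ge0; apply: Cneg.
    by rewrite scalerBl -(subrK x (_ *: e)) -addrA; apply: CD => //; exact: PC.
  have supE : has_sup E by split=> //; exists s.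
  exists (sup E); split=> t tE.
    have [u Eu tu] := sup_adherent (eps := sup E - t) (ltac:(by rewrite subr_gt0)) supE.
    rewrite -(subrK (u *: e) x) -addrA -scalerBl; apply: CD => //.
    by apply: CZ => //; lra.
  have [|] := Ctot (t *: e - x) => //; rewrite opprB => /(ub_le_sup (proj2 supE)).
  by rewrite leNgt tE.
have /choice[phi phiE] := cut_ex.
have cut_phi x a : cut x a -> phi x = a.
  by move=> xa; apply/eqP; rewrite eq_le !(cut_le x).
have cutD x y a b : cut x a -> cut y b -> cut (x + y) (a + b).
  move=> [xa ax] [yb bY]; split=> t tab; pose d := (t - (a + b)) / 2.
    have -> : t = (a + d) + (b + d) by rewrite /d; field.
    rewrite scalerDl opprD addrACA; apply: CD; [apply: xa|apply: yb]; rewrite /d; lra.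
  have -> : t = (a + d) + (b + d) by rewrite /d; field.
  rewrite scalerDl opprD addrACA; apply: CD; [apply: ax|apply: bY]; rewrite /d; lra.
have cutN x a : cut x a -> cut (- x) (- a).
  move=> [xa ax]; split=> t ta.
    by rewrite addrC -scaleNr; apply: ax; lra.
  by rewrite opprK addrC -[t]opprK scaleNr; apply: xa; lra.
have cutZ r x a : 0 < r -> cut x a -> cut (r *: x) (r * a).
  move=> r0 [xa ax]; split=> t ta.
    rewrite (_ : t = r * (t / r)); last by field; rewrite gt_eqF.
    rewrite -scalerA -scalerBr; apply: CZ; first exact: ltW.
    by apply: xa; rewrite ltr_pdivrMr// mulrC.
  rewrite (_ : t = r * (t / r)); last by field; rewrite gt_eqF.
  rewrite -scalerA -scalerBr; apply: CZ; first exact: ltW.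
  by apply: ax; rewrite ltr_pdivlMr// mulrC.
have cut0 : cut 0 0.
  split=> t t0; rewrite ?sub0r ?subr0 -?scaleNr; apply: CZ => //; lra.
exists phi; split.
- move=> r x y; apply: cut_phi; apply: (cutD) => //.
  have [r0|r0|->] := ltrgt0P r; last by rewrite scale0r mul0r.
    exact: cutZ.
  rewrite -[r]opprK scaleNr mulNr; apply/cutN/cutZ => //; lra.
- apply: cut_phi; split=> t t1.
    by rewrite -{1}(scale1r e) -scalerBl; apply: CZ => //; lra.
  by rewrite -{2}(scale1r e) -scalerBl; apply: CZ => //; lra.
- move=> x Px; rewrite leNgt; apply/negP => x0.
  have [_ /(_ (phi x / 2))] := phiE x => /(_ ltac:(lra)) Ct.
  have /Cneg : C ((phi x / 2) *: e) by rewrite -(subrK x (_ *: e)); apply: CD => //; exact: PC.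
  lra.
Qed.

End ConeSeparation.

(** * Complex vector spaces regarded as real ones *)

Section Realification.
Variables (R : realType) (V : lmodType R[i]).

Definition realification : Type := V.
HB.instance Definition _ := GRing.Zmodule.on realification.

Definition realification_scale (r : R) (x : realification) : realification :=
  r%:C *: (x : V).

Fact realification_scaleA r s x :
  realification_scale r (realification_scale s x) = realification_scale (r * s) x.
Proof. by rewrite /realification_scale rmorphM scalerA. Qed.

Fact realification_scale1 : left_id 1 realification_scale.
Proof. by move=> x; rewrite /realification_scale rmorph1 scale1r. Qed.

Fact realification_scaleDr : right_distributive realification_scale +%R.
Proof. by move=> r x y; rewrite /realification_scale scalerDr. Qed.

Fact realification_scaleDl x : {morph realification_scale^~ x : r s / r + s}.
Proof. by move=> r s; rewrite /realification_scale rmorphD scalerDl. Qed.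

HB.instance Definition _ := GRing.Zmodule_isLmodule.Build R realification
  realification_scaleA realification_scale1 realification_scaleDr realification_scaleDl.

Lemma realification_scaleE (r : R) (x : realification) : r *: x = (r%:C *: (x : V) : V).
Proof. by []. Qed.

End Realification.

(** * Existence of states fixing an isometry *)

Section StateExistence.
Variables (R : realType) (A : cstarAlgType R) (T U v0 v1 : A) (c : R).
Hypotheses (TT : star T * T = 1) (TU : star T * U = 0)
  (UU : star U * U = c%:C *: 1) (c0 : 0 < c).
Hypotheses (v00 : star v0 * v0 = 1) (v11 : star v1 * v1 = 1) (v01 : star v0 * v1 = 0).

Let defect := star (T - 1) * (T - 1).

(* For U a multiple of a wandering vector of T, the orbit sums
   V_N = U + T U + ... + T^(N-1) U satisfy V_N^*V_N = N c, whereas V_N^*defect V_N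
   stays equal to 2 c: they are approximate eigenvectors of T. *)
Let V := fix V N : A := if N is M.+1 then U + T * V M else 0.

Let UT : star U * T = 0.
Proof. by rewrite -[T]starK -starM TU star0. Qed.

Lemma orbit_sum_normsq N : star (V N) * V N = (N%:R * c)%:C *: 1.
Proof.
elim: N => [|N IH] /=; first by rewrite star0 mul0r mul0r scale0r.
rewrite starD starM mulrDr !mulrDl UU -(mulrA (star (V N))) TU mulr0 addr0.
rewrite mulrA UT mul0r add0r mulrA -(mulrA _ (star T)) TT mulr1 IH.
by rewrite -scalerDl -rmorphD -nat1r mulrDl mul1r.
Qed.

Lemma orbit_sum_defect N : (T - 1) * V N = T ^+ N * U - U.
Proof.
elim: N => [|N IH] /=; first by rewrite mulr0 mul1r subrr.
have comm : (T - 1) * T = T * (T - 1) by rewrite mulrBl mulrBr mul1r mulr1.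
rewrite mulrDr mulrA comm -mulrA IH mulrBr mulrA -exprS mulrBl mul1r.
by rewrite addrC addrA subrK.
Qed.

(** The sum telescopes to [T^(N+1) U - U], two orthogonal terms of square [c] whatever [N] is. For
    the empty sum the value is 0, hence [N.+1]. *)
Lemma orbit_sum_defect_form N : star (V N.+1) * defect * V N.+1 = (2 * c)%:C *: 1.
Proof.
rewrite /defect mulrA -starM -mulrA orbit_sum_defect starB mulrBl !mulrBr.
have UTU : star U * (T ^+ N.+1 * U) = 0 by rewrite exprS !mulrA UT !mul0r.
have UTU' : star (T ^+ N.+1 * U) * U = 0.
  by rewrite -[X in _ * X]starK -starM UTU star0.
have -> : star (T ^+ N.+1 * U) * (T ^+ N.+1 * U) = star U * U.
  rewrite starM -mulrA; congr (_ * _); rewrite mulrA starX.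
  elim: N.+1 => [|m IH]; first by rewrite !mul1r.
  by rewrite exprSr exprS mulrA -(mulrA _ (star T)) TT mulr1.
rewrite UTU UTU' UU subr0 sub0r opprK -scalerDl -rmorphD.
by congr (_%:C *: _); rewrite mulr2n mulrDl mul1r.
Qed.

(* A functional nonnegative on this cone vanishes on skew elements and on defect,
   and is nonnegative on squares. *)
Let cone : set (realification A) := [set x : A | exists (y : A) (l : R), 0 <= l /\
  x + star x = star y * y - l%:C *: defect].

Lemma star_defect : star defect = defect.
Proof. by rewrite /defect starM starK. Qed.

(** Two squares merge into the single square of [v0 a + v1 b], since [v0] and [v1] are isometries
    with orthogonal ranges; this is why one square suffices in [cone]. *)
Lemma cone_convex : convex_cone cone.
Proof.
split=> [x y [a [l [l0 xE]]] [b [m [m0 yE]]]|r x r0 [a [l [l0 xE]]]].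
  exists (v0 * a + v1 * b), (l + m); split; first exact: addr_ge0.
  have v10 : star v1 * v0 = 0 by rewrite -[v0]starK -starM v01 star0.
  have -> : star (v0 * a + v1 * b) * (v0 * a + v1 * b) = star a * a + star b * b.
    rewrite starD !starM mulrDr !mulrDl !mulrA.
    rewrite -!(mulrA _ (star v0)) -!(mulrA _ (star v1)) v00 v01 v10 v11.
    by rewrite !mulr1 !mulr0 !mul0r addr0 add0r.
  by rewrite starD addrACA xE yE rmorphD scalerDl opprD addrACA.
exists ((Num.sqrt r)%:C *: a), (r * l); split; first exact: mulr_ge0.
rewrite realification_scaleE starZ conj_real_complex -scalerDr xE starZ conj_real_complex.
rewrite -scalerAl -scalerAr scalerA -rmorphM -[Num.sqrt r * _]expr2 sqr_sqrtr//.
by rewrite scalerBr scalerA -rmorphM.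
Qed.

Lemma cone_square (x : A) : cone (star x * x).
Proof.
exists ((Num.sqrt 2)%:C *: x), 0; split=> //.
rewrite scale0r subr0 starM starK starZ conj_real_complex.
rewrite -scalerAl -scalerAr scalerA -rmorphM -[Num.sqrt 2 * _]expr2 sqr_sqrtr//.
by rewrite rmorph_nat scaler_nat mulr2n.
Qed.

Lemma cone_skew (x : A) : star x = - x -> cone x.
Proof.
by move=> xs; exists 0, 0; rewrite xs subrr star0 mul0r scale0r subrr.
Qed.

Lemma cone_opp_defect : cone (- defect).
Proof.
exists 0, 2; split=> //; rewrite mulr0 sub0r rmorph_nat scaler_nat mulr2n.
by rewrite starN star_defect opprD.
Qed.

(** With [h = x + star x], the element [2 t - h] equals [2 t (1 - h / (2 t))]. The choice of [t]
    brings [h / (2 t)] below norm 1/2, where [cstar_sqrt] gives a square root. *)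
Lemma cone_order_unit (x : realification A) :
  exists t : R, cone (t *: ((1 : A) : realification A) - x).
Proof.
pose h := (x : A) + star x.
have hs : star h = h by rewrite starD starK addrC.
pose t := cstar_norm h + 1; have t0 : 0 < t by rewrite ltr_wpDl ?cnorm_ge0.
have [||b [sb bb _]] := @cstar_sqrt _ _ ((2 * t)^-1%:C *: h).
- by rewrite starZ hs conj_real_complex.
- have t20 : 0 <= (2 * t)^-1 by rewrite invr_ge0 mulr_ge0// ltW.
  rewrite cnormZr (ger0_norm t20) invfM -mulrA ger_pMr ?invr_gt0//.
  by rewrite mulrC ler_pdivrMr// mul1r /t; lra.
exists t, ((Num.sqrt (2 * t))%:C *: b), 0; split=> //.
rewrite scale0r subr0 starZ conj_real_complex sb.
rewrite -scalerAl -scalerAr scalerA -rmorphM -[_ * Num.sqrt _]expr2 sqr_sqrtr; last first.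
  by rewrite mulr_ge0// ltW.
rewrite bb scalerBr scalerA -rmorphM mulfV ?gt_eqF ?mulr_gt0// rmorph1 scale1r.
rewrite realification_scaleE starB starZ star1 conj_real_complex addrACA -opprD -scalerDl.
by rewrite -rmorphD; congr (_%:C *: _ - _); rewrite mulr2n mulrDl mul1r.
Qed.

(** Membership of [- 1] means [star y * y = l defect - 2]. Compressed by [V N.+1], the right side
    becomes the scalar [2 c (l - (N + 1))], negative once [N + 1 > l], while the left side stays a
    square. *)
Lemma cone_proper : ~ cone (- (1 : A) : A).
Proof.
move=> [y [l [l0 yE]]].
pose N := Num.bound l.
have lN : l < N.+1%:R.
  by apply: lt_le_trans (archi_boundP l0) _; rewrite ler_nat.
apply: (@cstar_square_neq_neg _ _ (y * V N.+1) (2 * c * (N.+1%:R - l))).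
  by rewrite mulr_gt0 ?subr_gt0// mulr_gt0.
rewrite starM
  -(mulrA (star (V N.+1))) (mulrA (star y)) (_ : star y * y = l%:C *: defect - 2 *: 1); last first.
  have -> : star y * y = - 1 + star (- 1 : A) + l%:C *: defect by rewrite yE subrK.
  by rewrite starN star1 addrC scaler_nat mulr2n opprD.
rewrite mulrBl mulrBr -scalerAl -scalerAr mulrA orbit_sum_defect_form.
rewrite -scalerAl mul1r -scalerAr orbit_sum_normsq.
rewrite !scalerA -scalerBl; congr (_ *: _).
rewrite -(rmorph_nat (real_complex R)) -!rmorphM -rmorphB -rmorphN; congr (_%:C).
ring.
Qed.

Lemma isometry_fixing_state : exists2 w : A -> R[i], is_state w & w defect = 0.
Proof.
have cone1 : cone (1 : A) by have := cone_square 1; rewrite star1 mulr1.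
have [phi [lin phi1 phiP]] := positive_functional cone_convex cone1 cone_order_unit cone_proper.
have phiD (x y : A) : phi (x + y) = phi x + phi y.
  by have := lin 1 x y; rewrite scale1r mul1r.
have phi0 : phi (0 : A) = 0 by apply: (addrI (phi (0 : A))); rewrite -phiD !addr0.
have phiN (x : A) : phi (- x) = - phi x.
  by apply: (addrI (phi x)); rewrite -phiD !subrr.
have phiZ r (x : A) : phi (r%:C *: x) = r * phi x.
  by have := lin r x 0; rewrite !addr0 phi0 addr0.
have phi_skew (x : A) : star x = - x -> phi x = 0.
  move=> xs; apply/eqP; rewrite eq_le phiP ?andbT; last exact: cone_skew.
  by rewrite -oppr_ge0 -phiN phiP//; apply: cone_skew; rewrite starN xs.
have phi_i (x : A) : star x = x -> phi ('i *: x) = 0.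
  by move=> xs; apply: phi_skew; rewrite starZ xs conj_i scaleNr.
(* The usual complexification of a real-linear functional. It agrees with [phi] on self-adjoint [x],
   because [i x] is then skew. *)
pose w (x : A) : R[i] := (phi x)%:C - 'i * (phi ('i *: x))%:C.
have w_sa (x : A) : star x = x -> w x = (phi x)%:C.
  by move=> xs; rewrite /w phi_i// rmorph0 mulr0 subr0.
exists w; first split.
- move=> [a b] x y.
  have iiN (u : A) : 'i *: ('i *: u) = - u.
    by rewrite scalerA -['i * 'i]expr2 sqr_i scaleN1r.
  have sc (u : A) : (a +i* b)%C *: u = a%:C *: u + b%:C *: ('i *: u).
    rewrite scalerA -scalerDl; congr (_ *: _); apply/eqP.
    by rewrite eq_complex /=; apply/andP; split; apply/eqP; ring.
  have iZ (r : R) (u : A) : 'i *: (r%:C *: u) = r%:C *: ('i *: u).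
    by rewrite !scalerA mulrC.
  rewrite /w !scalerDr !phiD sc !scalerDr !phiD !iZ iiN !phiZ phiN.
  by apply/eqP; rewrite eq_complex /=; apply/andP; split; apply/eqP; ring.
- by move=> x; rewrite w_sa ?starM ?starK// ler0c phiP//; exact: cone_square.
- by rewrite w_sa ?star1// phi1.
rewrite w_sa ?star_defect// (_ : phi defect = 0)//; apply/eqP; rewrite eq_le phiP ?andbT.
  by rewrite -oppr_ge0 -phiN phiP//; exact: cone_opp_defect.
exact: cone_square.
Qed.

End StateExistence.

(** * Elementary properties of states *)

Section StateTheory.
Variables (R : realType) (A : cstarAlgType R) (w : A -> R[i]).
Hypothesis ws : is_state w.
Implicit Types x y h : A.

Lemma stateD x y : w (x + y) = w x + w y.
Proof. by have := state_linear ws 1 x y; rewrite scale1r mul1r. Qed.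

Lemma state0 : w 0 = 0.
Proof. by apply: (addrI (w 0)); rewrite -stateD !addr0. Qed.

Lemma stateZ (a : R[i]) x : w (a *: x) = a * w x.
Proof. by have := state_linear ws a x 0; rewrite !addr0 state0 addr0. Qed.

Lemma stateN x : w (- x) = - w x.
Proof. by rewrite -scaleN1r stateZ mulN1r. Qed.

Lemma state_sum (I : Type) (r : seq I) (P : pred I) (F : I -> A) :
  w (\sum_(i <- r | P i) F i) = \sum_(i <- r | P i) w (F i).
Proof. exact: (big_morph _ stateD state0). Qed.

(** Positivity at [1 + y] makes [w y + w (star y)] real. Taking [y = x] and [y = i x] settles the
    imaginary and the real part. *)
Lemma state_star x : w (star x) = (w x)^*.
Proof.
have im0 y : complex.Im (w y + w (star y)) = 0.
  have := ger0_Im (state_ge0 ws (1 + y)).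
  rewrite starD star1 mulrDl mul1r mulrDr mulr1 !stateD (state1 ws).
  have /= := ger0_Im (state_ge0 ws y).
  move: (w y) (w (star y)) (w (star y * y)) => [a b] [a' b'] [p q] /= ->.
  by rewrite !add0r addr0.
have := im0 x; have := im0 ('i *: x).
rewrite starZ conj_i !stateZ.
case: (w x) => a b; case: (w (star x)) => a' b' /= h1 h2.
have conjE : (a +i* b)%C^* = (a +i* - b)%C by [].
by rewrite conjE; apply/eqP; rewrite eq_complex /=; apply/andP; split; apply/eqP; lra.
Qed.

Lemma state_null x : w (star x * x) = 0 -> forall y, w (y * x) = 0.
Proof.
move=> wx y; apply/eqP; apply/negPn/negP => v0; set v := w (y * x) in v0.
pose M := w (y * star y).
have M0 : 0 <= M by have := state_ge0 ws (star y); rewrite starK.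
(* Each cross term becomes [- (M + 1) / 2], so the square of [star y + l x] would have value
   [M - (M + 1) = - 1]. *)
pose l := - (M + 1) / (2 * v).
have lv : l * v = - (M + 1) / 2 by rewrite /l; field.
have := state_ge0 ws (star y + l *: x).
rewrite starD starK starZ mulrDr !mulrDl -!scalerAl -!scalerAr scalerA !stateD !stateZ.
rewrite wx mulr0 addr0 -/v -/M lv -[star x * star y]starM state_star -/v.
rewrite (_ : l^* * v^* = (l * v)^*); last by rewrite [RHS]rmorphM.
rewrite lv conj_Creal; last first.
  by rewrite realM// ?realN ?realD ?ger0_real// invr_ge0.
have -> : M + - (M + 1) / 2 + - (M + 1) / 2 = - 1 by field.
by rewrite oppr_ge0 ler10.
Qed.

(** A crude bound that gives continuity. For self-adjoint [h] of norm at most 1/2, [1 - h] is a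
    square, so [w h <= 1]; this costs a factor 2, and splitting [x] into self-adjoint parts costs
    another. *)
Lemma state_le_cnorm x : `|w x| <= (4 * cstar_norm x)%:C.
Proof.
have half h : star h = h -> cstar_norm h <= 2^-1 -> w h <= 1.
  move=> hs hn; have [b [sb bb _]] := cstar_sqrt hs hn.
  by have := state_ge0 ws b; rewrite sb bb stateD stateN (state1 ws) subr_ge0.
have sa_le h : star h = h -> w h <= (2 * cstar_norm h)%:C.
  move=> hs; have := cnorm_ge0 h; rewrite le_eqVlt => /predU1P[/esym h0|h0].
    by rewrite h0 mulr0 (cstar_norm0_eq0 _ h0) state0.
  have t0 : 0 < 2 * cstar_norm h by rewrite mulr_gt0.
  have := half ((2 * cstar_norm h)^-1%:C *: h).
  rewrite starZ hs conj_real_complex cnormZr gtr0_norm ?invr_gt0// invfM -mulrA.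
  rewrite mulVf ?gt_eqF// mulr1 => /(_ erefl (lexx _)).
  rewrite -invfM stateZ fmorphV /= mulrC ler_pdivrMr ?mul1r//.
  by rewrite ltcR.
have sa_norm h : star h = h -> `|w h| <= (2 * cstar_norm h)%:C.
  move=> hs; have wr : w h \is Num.real by apply/CrealP; rewrite -state_star hs.
  rewrite real_ler_norml// sa_le// andbT lerNl -stateN -[in leRHS]cnormN.
  by apply: sa_le; rewrite starN hs.
have i1 : `|'i : R[i]| = 1.
  by rewrite normc_def /= expr0n expr1n add0r sqrtr1.
pose a := x + star x; pose b := 'i *: (x - star x).
have na : cstar_norm a <= 2 * cstar_norm x.
  by have := cstar_normD x (star x); rewrite cnorm_star -/a; lra.
have nb : cstar_norm b <= 2 * cstar_norm x.
  rewrite cstar_normZ (_ : normc _ = 1) ?mul1r; last first.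
    by rewrite /normc /= expr0n expr1n add0r sqrtr1.
  by have := cnormB x (star x); rewrite cnorm_star; lra.
have sa : star a = a by rewrite starD starK addrC.
have sb : star b = b by rewrite starZ starB starK conj_i scaleNr -scalerN opprB.
have xE : 2 * w x = w a - 'i * w b.
  rewrite stateZ mulrA -['i * 'i]expr2 sqr_i mulN1r opprK -stateD.
  rewrite -stateZ; congr w; rewrite /a addrACA subrr addr0.
  by rewrite scaler_nat mulr2n.
rewrite -(ler_pM2l (ltr0Sn _ 1)) -{1}[2]ger0_norm// -normrM xE.
apply: le_trans (ler_normB _ _) _; rewrite normrM i1 mul1r.
apply: le_trans (lerD (sa_norm _ sa) (sa_norm _ sb)) _.
rewrite -(rmorph_nat (real_complex R)) -rmorphD -rmorphM lecR; lra.
Qed.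

End StateTheory.

(** * The isometries defining geometric progression states *)

Section CuntzCode.
Variables (R : realType) (A : cstarAlgType R) (e : nat -> A) (d k : nat).
Hypothesis d_gt0 : (0 < d)%N.
Hypothesis erel : forall i j, (i <= d)%N -> (j <= d)%N -> star (e i) * e j = (i == j)%:R.

(* With d = n - 1 and e i = s_(i+1): the isometries s_n^r s_i (r < k, i < n) and
   s_n^k, numbered from 0. *)
Definition code (j : nat) : A :=
  e d ^+ (j %/ d) * (if (j < d * k)%N then e (j %% d) else 1).

Definition code_sum (z : 'rV[R[i]]_(d * k).+1) : A := \sum_j z 0 j *: code j.

Definition code_defect z := star (code_sum z - 1) * (code_sum z - 1).

Lemma code_lt r i : (r < k)%N -> (i < d)%N -> code (d * r + i) = e d ^+ r * e i.
Proof.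
move=> rk id; rewrite /code mulnC divnMDl// divn_small// addn0 modnMDl modn_small//.
rewrite (_ : (r * d + i < d * k)%N = true)//; nia.
Qed.

Lemma code_last : code (d * k) = e d ^+ k.
Proof. by rewrite /code ltnn mulr1 mulKn. Qed.

Lemma code_indexP (j : nat) : (j < (d * k).+1)%N ->
  (exists r i, [/\ (r < k)%N, (i < d)%N & j = (d * r + i)%N]) \/ j = (d * k)%N.
Proof.
rewrite ltnS leq_eqVlt => /predU1P[->|jk]; [by right|left].
exists (j %/ d)%N, (j %% d)%N; rewrite ltn_mod d_gt0 ltn_divLR// mulnC jk; split=> //.
by rewrite mulnC -divn_eq.
Qed.

Lemma isometry_exprK r (x : A) : star (e d ^+ r) * (e d ^+ r * x) = x.
Proof.
rewrite starX; elim: r x => [|r IH] x; first by rewrite !mul1r.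
by rewrite [star (e d) ^+ _]exprSr [e d ^+ _.+1]exprS -!mulrA (mulrA (star (e d))) erel//
  eqxx mul1r IH.
Qed.

(** Copies of [e d] cancel one by one; if [c > r], a remaining copy meets [star (e i)] with [i < d]
    and gives 0. *)
Lemma star_code_expr r i c : (i < d)%N ->
  star (e d ^+ r * e i) * e d ^+ c =
    if (c <= r)%N then star (e d ^+ (r - c) * e i) else 0.
Proof.
move=> id; rewrite starM; case: leqP => [cr|rc].
  have ecc : star (e d ^+ c) * e d ^+ c = 1 by have := isometry_exprK c 1; rewrite !mulr1.
  by rewrite -{1}(subnKC cr) exprD !starM -!mulrA ecc mulr1.
rewrite -(subnKC (ltnW rc)) exprD -mulrA isometry_exprK.
have := rc; rewrite -subn_gt0; case: (c - r)%N => // m _.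
by rewrite exprS mulrA erel ?(ltnW id)// (ltn_eqF id) mul0r.
Qed.

(** The words behind [code] form a prefix code: none is a proper prefix of another, so their ranges
    are orthogonal. *)
Lemma code_isometry (i j : 'I_(d * k).+1) : star (code i) * code j = (i == j)%:R.
Proof.
have lt_case r a s b : (a < d)%N -> (b < d)%N ->
    star (e d ^+ r * e a) * (e d ^+ s * e b) = (d * r + a == d * s + b)%:R.
  move=> ad bd; rewrite mulrA star_code_expr//; case: (ltngtP s r) => [sr|rs|->].
  - have := subnKC (ltnW sr); move: sr; rewrite -subn_gt0; case: (r - s)%N => // m _ rE.
    rewrite exprS starM -mulrA starM -mulrA erel ?(ltnW bd)// (gtn_eqF bd).
    rewrite !mulr0 (_ : (_ == _) = false)//; apply/eqP; nia.
  - rewrite mul0r (_ : (_ == _) = false)//; apply/eqP; nia.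
  - by rewrite subnn mul1r erel ?(ltnW ad)// ?(ltnW bd)// eqn_add2l.
have last_case s b : (s < k)%N -> (b < d)%N ->
    star (e d ^+ s * e b) * code (d * k) = (d * s + b == d * k)%:R.
  move=> sk bd; rewrite code_last star_code_expr// leqNgt sk /=.
  rewrite (_ : (_ == _) = false)//; apply/eqP; nia.
have [[r [a [rk ad iE]]]|iE] := code_indexP (ltn_ord i);
  have [[s [b [sk bd jE]]]|jE] := code_indexP (ltn_ord j).
- rewrite -val_eqE /= iE jE !code_lt//. exact: lt_case.
- by rewrite -val_eqE /= iE jE !code_lt// last_case.
- rewrite -val_eqE /= iE jE -[code (d * s + b)]starK -starM !code_lt//.
  by rewrite last_case// eq_sym; case: (_ == _); rewrite ?star1 ?star0.
- rewrite -val_eqE /= iE jE eqxx code_last.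
  by have := isometry_exprK k 1; rewrite !mulr1.
Qed.

Lemma star_code_sum (z : 'rV_(d * k).+1) (j : 'I_(d * k).+1) :
  star (code j) * code_sum z = z 0 j *: 1.
Proof.
rewrite mulr_sumr (bigD1 j)//= -scalerAr code_isometry eqxx big1 ?addr0// => i ij.
by rewrite -scalerAr code_isometry eq_sym (negbTE ij) scaler0.
Qed.

Lemma code_sum_normsq (z : 'rV_(d * k).+1) :
  star (code_sum z) * code_sum z = (\sum_j `|z 0 j| ^+ 2) *: 1.
Proof.
rewrite {1}/code_sum star_sum mulr_suml scaler_suml; apply: eq_bigr => j _.
by rewrite starZ -scalerAl star_code_sum scalerA normCKC.
Qed.

Section Fixed.
Variables (w : A -> R[i]) (z : 'rV[R[i]]_(d * k).+1).
Hypothesis ws : is_state w.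

Lemma fixed_mul : w (code_defect z) = 0 -> forall y, w (y * code_sum z) = w y.
Proof.
move=> /(state_null ws) null y; have := null y.
by rewrite mulrBr mulr1 stateD// stateN// => /eqP; rewrite subr_eq0 => /eqP.
Qed.

(** Write [T] for the code sum, an isometry, and [t_j] for its terms. The prescribed values give
    [w T = 1], which makes the defect [2 - 2 Re (w T)] vanish. Conversely,
    [w (star t_j) = w (star t_j * T) = z_j]. *)
Lemma code_valuesP : \sum_j `|z 0 j| ^+ 2 = 1 ->
  (forall j : 'I_(d * k).+1, w (code j) = (z 0 j)^*) <-> w (code_defect z) = 0.
Proof.
move=> z1; split=> [wz|/fixed_mul fixed j].
  have wT : w (code_sum z) = 1.
    rewrite state_sum// -z1; apply: eq_bigr => j _.
    by rewrite stateZ// wz normCK.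
  rewrite /code_defect starB star1 mulrBl mul1r mulrBr code_sum_normsq z1 scale1r mulr1.
  by rewrite !(stateD, stateN)// state_star// wT (state1 ws) rmorph1 !subrr.
have := fixed (star (code j)); rewrite star_code_sum stateZ// (state1 ws) mulr1 state_star//.
by move=> ->; rewrite conjCK.
Qed.

End Fixed.

Lemma fixing_state_exists (z : 'rV[R[i]]_(d * k).+1) :
  \sum_j `|z 0 j| ^+ 2 = 1 -> `|z 0 ord_max| < 1 ->
  exists2 w : A -> R[i], is_state w & w (code_defect z) = 0.
Proof.
move=> z1 zm; pose T := code_sum z; pose t := code (d * k).
(* [U] is the component of [t] orthogonal to [T]; its square is the scalar [1 - |a|^2], positive by
   [zm]. *)
pose a := z 0 ord_max; pose U := t - a^* *: T.
have TT : star T * T = 1 by rewrite code_sum_normsq z1 scale1r.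
have tT : star t * T = a *: 1 by rewrite (star_code_sum z ord_max).
have Tt : star T * t = a^* *: 1 by rewrite -[t]starK -starM tT starZ star1.
have TU : star T * U = 0 by rewrite mulrBr Tt -scalerAr TT subrr.
have tt : star t * t = 1 by rewrite (code_isometry ord_max ord_max) eqxx.
pose c := 1 - complex.Re (`|a| ^+ 2).
have cE : c%:C = 1 - `|a| ^+ 2.
  by rewrite /c rmorphB rmorph1; congr (_ - _); apply: RRe_real; rewrite realX// normr_real.
apply: (@isometry_fixing_state _ _ T U (e d) (e 0) c) => //.
- rewrite {1}/U starB mulrBl starZ -scalerAl TU scaler0 subr0 mulrBr tt -scalerAr tT.
  by rewrite scalerA cE scalerBl scale1r mulrC normCK.
- by rewrite -ltcR cE rmorph0 subr_gt0 expr_lt1.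
- by rewrite erel// eqxx.
- by rewrite erel// eqxx.
- by rewrite erel// (gtn_eqF d_gt0).
Qed.

End CuntzCode.

(** * Uniqueness *)

Section Uniqueness.
Variables (R : realType) (A : cstarAlgType R) (e : nat -> A) (d k : nat).
Hypotheses (d_gt0 : (0 < d)%N) (k_gt0 : (0 < k)%N).
Hypothesis erel : forall i j, (i <= d)%N -> (j <= d)%N -> star (e i) * e j = (i == j)%:R.
Hypothesis egen : forall S : set A, cstar_subalgebra S ->
  (forall i, (i <= d)%N -> S (e i)) -> S = setT.
Variable (z : 'rV[R[i]]_(d * k).+1).
Hypothesis z_last : `|z 0 ord_max| < 1.
Variables (w1 w2 : A -> R[i]).
Hypotheses (ws1 : is_state w1) (ws2 : is_state w2).
Hypotheses (wz1 : w1 (code_defect e z) = 0) (wz2 : w2 (code_defect e z) = 0).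

Local Notation T := (code_sum e z).
Let delta x := w1 x - w2 x.

Lemma deltaD x y : delta (x + y) = delta x + delta y.
Proof. by rewrite /delta !stateD// opprD addrACA. Qed.

Lemma deltaZ a x : delta (a *: x) = a * delta x.
Proof. by rewrite /delta !stateZ// mulrBr. Qed.

Lemma delta0 : delta 0 = 0.
Proof. by rewrite /delta !state0// subrr. Qed.

Lemma delta1 : delta 1 = 0.
Proof. by rewrite /delta (state1 ws1) (state1 ws2) subrr. Qed.

Lemma delta_star x : delta (star x) = (delta x)^*.
Proof. by rewrite /delta !state_star// rmorphB. Qed.

Lemma delta_mulT y : delta (y * T) = delta y.
Proof. by rewrite /delta !fixed_mul. Qed.

Lemma delta_Tmul y : delta (star T * y) = delta y.
Proof. by rewrite -[LHS]conjCK -delta_star starM starK delta_mulT delta_star conjCK. Qed.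

(** Both states absorb [T] on the right, and [star t_j * T = z_j] for the code word [t_j]; adjoints
    move this to the left of [y]. *)
Lemma delta_code (j : 'I_(d * k).+1) y : delta (code e d k j * y) = (z 0 j)^* * delta y.
Proof.
rewrite -[LHS]conjCK -delta_star starM -delta_mulT -mulrA star_code_sum//.
by rewrite -scalerAr mulr1 deltaZ delta_star rmorphM/= conjCK.
Qed.

Lemma delta_code_lt0 r i y : (r < k)%N -> (i < d)%N -> delta y = 0 ->
  delta (e d ^+ r * e i * y) = 0.
Proof.
move=> rk id y0; have jk : (d * r + i < (d * k).+1)%N by nia.
by have := delta_code (Ordinal jk) y; rewrite /= code_lt// y0 mulr0.
Qed.

(* As |z_m| < 1, the two relations expressing each of s_n^c and s_n^(k-c) in
   terms of the other force both values to vanish. *)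
Lemma delta_expr0 c : (c < k)%N -> delta (e d ^+ c) = 0.
Proof.
(* After inserting [star T] only the last summand survives: the others are zero or multiples of
   adjoints of code words [s_n^r s_i], on which [delta] vanishes. *)
have rel b : (0 < b < k)%N ->
    delta (e d ^+ b) = (z 0 ord_max)^* * (delta (e d ^+ (k - b)))^*.
  move=> /andP[b0 bk]; rewrite -delta_Tmul /code_sum star_sum mulr_suml.
  rewrite (big_morph delta deltaD delta0) (bigD1 ord_max)//= big1 ?addr0.
    rewrite starZ -scalerAl deltaZ code_last// -delta_star; congr (_ * delta _).
    have := isometry_exprK erel b 1.
    rewrite mulr1 -{1}(subnKC (ltnW bk)) exprD !starM -mulrA => ->.
    by rewrite mulr1.
  move=> j jmax; rewrite starZ -scalerAl deltaZ.
  have [[r [i [rk id jE]]]|jE] := code_indexP d_gt0 (ltn_ord j); last first.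
    by case/eqP: jmax; apply: val_inj.
  rewrite jE code_lt// star_code_expr//; case: leqP => br; rewrite ?delta0 ?mulr0//.
  rewrite delta_star -[X in delta X]mulr1 delta_code_lt0 ?rmorph0 ?mulr0 ?delta1//.
  by rewrite (leq_ltn_trans (leq_subr _ _)).
case: c => [|c] ck; first exact: delta1.
set b := c.+1 in ck *; have b0 : (0 < b)%N by [].
have := rel b; rewrite b0 ck => /(_ isT) E1.
have := rel (k - b)%N; rewrite subn_gt0 ck ltn_subrL b0 k_gt0 subKn ?(ltnW ck)// => /(_ isT) E2.
apply/eqP/negPn/negP => n0.
have : `|delta (e d ^+ b)| = `|z 0 ord_max| ^+ 2 * `|delta (e d ^+ b)|.
  by rewrite {1}E1 normrM !norm_conjC E2 normrM !norm_conjC mulrA -expr2.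
move/eqP; rewrite -subr_eq0 -{1}[`|_|]mul1r -mulrBl mulf_eq0 normr_eq0 (negbTE n0) orbF.
by rewrite subr_eq0 eq_sym lt_eqF// expr_lt1.
Qed.

(** * Vanishing of the difference of two states on words *)

Definition word (J : seq nat) : A := \prod_(i <- J) e i.
Local Notation letters := (all (fun i => (i <= d)%N)).

(** Code words are stripped from the left. In the strengthened induction, [c] counts the letters [d]
    read since the last complete code word; a letter below [d], or the [k]-th [d], completes one and
    [delta_code] removes it. *)
Lemma delta_word y : (forall c, (c < k)%N -> delta (e d ^+ c * y) = 0) ->
  forall J, letters J -> delta (word J * y) = 0.
Proof.
move=> y0 J; suff H c : (c < k)%N -> letters J -> delta (e d ^+ c * (word J * y)) = 0.
  by move=> /(H 0) ; rewrite mul1r; apply.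
elim: J c => [|i J IH] c ck /=; first by rewrite /word big_nil mul1r => _; exact: y0.
move=> /andP[]; rewrite leq_eqVlt /word big_cons -/(word J) => /predU1P[->|id] lJ.
  rewrite -mulrA mulrA -exprSr; have [ck'|kc] := ltnP c.+1 k; first exact: IH.
  have -> : c.+1 = k by apply/eqP; rewrite eqn_leq ck kc.
  rewrite -(code_last e k d_gt0); have := delta_code ord_max (word J * y) => /= ->.
  by rewrite -[word J * y]mul1r (IH 0)// mulr0.
rewrite -mulrA mulrA delta_code_lt0//.
by rewrite -[word J * y]mul1r (IH 0).
Qed.

Lemma delta_star_word K : letters K -> delta (star (word K)) = 0.
Proof.
move=> lK; rewrite delta_star -[word K]mulr1 delta_word ?rmorph0// => c ck.
by rewrite mulr1 delta_expr0.
Qed.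

(** [delta_word] reduces to [s_n^c s_K^*] with [c < k]. Inserting [star T] then helps, since each
    [star t_j * s_n^c] is zero or the adjoint of a word, leaving only adjoints of words. *)
Lemma delta_word_star_word J K : letters J -> letters K ->
  delta (word J * star (word K)) = 0.
Proof.
move=> lJ lK; apply: delta_word lJ => c ck.
have nseqE b : e d ^+ b = word (nseq b d).
  by elim: b => [|b IH]; rewrite /word ?big_nil//= big_cons exprS IH.
rewrite -delta_Tmul /code_sum star_sum mulr_suml (big_morph delta deltaD delta0) big1//.
move=> j _; rewrite starZ -scalerAl deltaZ mulrA.
have words L : letters L -> delta (star (word L) * star (word K)) = 0.
  by move=> lL; rewrite -starM /word -big_cat delta_star_word// all_cat lK.
have lnseq b : letters (nseq b d) by rewrite all_nseq leqnn orbT.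
have [[r [i [rk id jE]]]|jE] := code_indexP d_gt0 (ltn_ord j).
  rewrite jE code_lt// star_code_expr//; case: leqP => cr; last by rewrite mul0r delta0 mulr0.
  rewrite (_ : e d ^+ _ * e i = word (rcons (nseq (r - c) d) i)); last first.
    by rewrite nseqE /word big_rcons.
  by rewrite words ?mulr0// all_rcons (ltnW id) lnseq.
rewrite jE code_last// (_ : star _ * _ = star (word (nseq (k - c) d))).
  by rewrite words ?mulr0.
have := isometry_exprK erel c 1; rewrite mulr1 -nseqE => ecc.
by rewrite -{1}(subnKC (ltnW ck)) exprD starM -mulrA ecc mulr1.
Qed.

Lemma fixing_state_unique : w1 = w2.
Proof.
(* Instead of using density of the span of the [s_J s_K^*], the proof shows that left multiplication
   by any element preserves [D], which contains [1]. *)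
pose D : set A := [set x | forall J K, letters J -> letters K ->
  delta (word J * star (word K) * x) = 0].
have delta_le x : `|delta x| <= (8 * cstar_norm x)%:C.
  apply: le_trans (ler_normB _ _) _.
  apply: le_trans (lerD (state_le_cnorm ws1 x) (state_le_cnorm ws2 x)) _.
  by rewrite -rmorphD lecR; lra.
have DZD a x y : D x -> D y -> D (a *: x + y).
  move=> Dx Dy J K lJ lK; rewrite mulrDr -scalerAr deltaD deltaZ Dx// Dy//.
  by rewrite mulr0 addr0.
(* [star (word K) * e i] loses the first letter of [K] or vanishes; for empty [K], the letter [i] is
   appended to [J]. *)
have De i y : (i <= d)%N -> D y -> D (e i * y).
  move=> id Dy J [|i' K] lJ lK.
    rewrite /word big_nil star1 mulr1 mulrA.
    have := Dy (rcons J i) [::]; rewrite /word big_rcons big_nil star1 mulr1; apply=> //.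
    by rewrite all_rcons id.
  move: lK => /= /andP[i'd lK].
  rewrite {2}/word big_cons starM -!mulrA (mulrA (star (e i'))) erel//.
  have := Dy J K lJ lK; rewrite -mulrA.
  by case: (i' == i); rewrite ?mul1r// mul0r !mulr0 delta0.
have Des i y : (i <= d)%N -> D y -> D (star (e i) * y).
  move=> id Dy J K lJ lK; rewrite mulrA -(mulrA (word J)) -starM.
  by have := Dy J (i :: K); rewrite /word big_cons; apply=> //=; rewrite id.
have Dclosed x : (forall r : R, 0 < r -> exists y, D y /\ cstar_norm (x - y) < r) -> D x.
  move=> xlim J K lJ lK; set p := word J * star (word K).
  apply/eqP; rewrite -normr_le0.
  have -> : `|delta (p * x)| = (complex.Re `|delta (p * x)|)%:C.
    by rewrite RRe_real// normr_real.
  rewrite -(rmorph0 (real_complex R)) lecR.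
  apply: (@small_le0 _ _ (8 * cstar_norm p)) => r r0; have [y [Dy xy]] := xlim _ r0.
  rewrite -lecR RRe_real ?normr_real//.
  have -> : delta (p * x) = delta (p * (x - y)).
    by rewrite mulrBr -scaleN1r deltaD deltaZ Dy// mulr0 addr0.
  apply: le_trans (delta_le _) _; rewrite lecR -mulrA ler_pM2l//.
  apply: le_trans (cstar_normM _ _) _.
  by rewrite ler_wpM2l ?cnorm_ge0// ltW.
(* The condition on [star x] makes these multipliers of [D] closed under adjoints, so that
   generation by the [e i] applies to [S]. *)
pose S : set A := [set x | forall y, D y -> D (x * y) /\ D (star x * y)].
have SE : S = setT.
  apply: egen; last by move=> i id y Dy; split; [exact: De|exact: Des].
  split.
  - by move=> y Dy; rewrite star1 mul1r.
  - move=> a x y Sx Sy u Du; have [xu xu'] := Sx u Du; have [yu yu'] := Sy u Du.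
    by rewrite starD starZ !mulrDl -!scalerAl; split; exact: DZD.
  - move=> x y Sx Sy u Du; rewrite starM -!mulrA.
    by split; [apply: (Sx _ _).1; apply: (Sy _ _).1|apply: (Sy _ _).2; apply: (Sx _ _).2].
  - by move=> x Sx u Du; rewrite starK; have [] := Sx u Du.
  - move=> x xlim u Du.
    have near r : 0 < r -> exists y, S y /\ cstar_norm (x - y) * cstar_norm u < r.
      move=> r0; have u1 : 0 < cstar_norm u + 1 by rewrite ltr_wpDl ?cnorm_ge0.
      have [y [Sy]] := xlim _ (divr_gt0 r0 u1); rewrite ltr_pdivlMr// => xy.
      by exists y; split=> //; have := cnorm_ge0 (x - y); lra.
    split; apply: Dclosed => r /near[y [Sy xy]].
      exists (y * u); split; first exact: (Sy _ Du).1.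
      by rewrite -mulrBl; apply: le_lt_trans xy; exact: cstar_normM.
    exists (star y * u); split; first exact: (Sy _ Du).2.
    by rewrite -mulrBl -starB; apply: le_lt_trans (cstar_normM _ _) _; rewrite cnorm_star.
have D1 : D 1 by move=> J K lJ lK; rewrite mulr1 delta_word_star_word.
apply/funext => x; apply/eqP; rewrite -subr_eq0; apply/eqP.
have Sx : S x by rewrite SE.
have [+ _] := Sx _ D1.
by move=> /(_ [::] [::] isT isT); rewrite /word big_nil star1 !mul1r mulr1.
Qed.

End Uniqueness.

(** * Geometric progression states and the map psi *)

Section GeometricStates.
Variables (R : realType) (n : nat) (A : cstarAlgType R) (s : n.-tuple A).
Hypotheses (n_ge2 : (2 <= n)%N) (sO : is_cuntz_algebra s).
Local Notation e := (nth 0 s).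
Local Notation d := n.-1.

Let d_gt0 : (0 < d)%N. Proof. by rewrite -subn1 subn_gt0. Qed.

Let lt_gen i : (i <= d)%N -> (i < n)%N.
Proof. by move=> id; rewrite -(ltn_predK n_ge2) ltnS. Qed.

Let erel i j : (i <= d)%N -> (j <= d)%N -> star (e i) * e j = (i == j)%:R.
Proof.
move=> /lt_gen id /lt_gen jd.
by have := (cuntz_rel sO).1 (Ordinal id) (Ordinal jd); rewrite !(tnth_nth 0).
Qed.

Let egen (S : set A) : cstar_subalgebra S -> (forall i, (i <= d)%N -> S (e i)) -> S = setT.
Proof.
move=> Ssub Se; apply: (cuntz_generated sO Ssub) => i; rewrite (tnth_nth 0); apply: Se.
by rewrite -ltnS (ltn_predK n_ge2).
Qed.

Lemma coord_last m (z : 'rV[R[i]]_m.+1) : Defs.coord z m.+1 = z 0 ord_max.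
Proof. by rewrite /Defs.coord/=; congr (z 0 _); apply: val_inj; rewrite /= inordK. Qed.

Lemma WP k (z : 'rV[R[i]]_(d * k).+1) :
  W z <-> \sum_j `|z 0 j| ^+ 2 = 1 /\ `|z 0 ord_max| < 1.
Proof.
rewrite /W /Wset /= /euclidean_norm coord_last; split=> -[z1 zl]; split=> //.
  by rewrite -[LHS]sqrtCK z1 expr1n.
by rewrite z1 sqrtC1.
Qed.

(** Passes from the 1-based generators and coordinates of the definition to the 0-based code
    words. *)
Lemma is_geometric_stateP k (z : 'rV[R[i]]_(d * k).+1) w : \sum_j `|z 0 j| ^+ 2 = 1 ->
  is_geometric_state s z w <-> is_state w /\ w (code_defect e z) = 0.
Proof.
move=> z1; split=> [[ws wlt wlast]|[ws wz]].
  split=> //; apply/(code_valuesP d_gt0 erel ws z1) => j.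
  have [[r [i [rk id jE]]]|jE] := code_indexP d_gt0 (ltn_ord j).
    rewrite jE code_lt//; have := wlt r i.+1 rk id; rewrite /gen /= => ->.
    by rewrite /Defs.coord addnS /= -jE inord_val.
  rewrite jE code_last//; move: wlast; rewrite /gen coord_last => ->.
  by congr ((z 0 _)^*); apply: val_inj.
have wc := (code_valuesP d_gt0 erel ws z1).2 wz; split=> //.
  move=> r [//|i] rk /= id; rewrite /gen /= -(code_lt e d_gt0 rk id).
  have jk : (d * r + i < (d * k).+1)%N by nia.
  have /= -> := wc (Ordinal jk); rewrite /Defs.coord addnS /=.
  by congr ((z 0 _)^*); apply: val_inj; rewrite /= inordK.
by rewrite coord_last /gen -(code_last e k d_gt0) (wc ord_max).
Qed.

Lemma geometric_state_exists k (z : 'rV[R[i]]_(d * k).+1) : (0 < k)%N -> W z ->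
  exists w, is_geometric_state s z w.
Proof.
move=> k0 /WP[z1 zl]; have [w ws wz] := fixing_state_exists d_gt0 erel z1 zl.
by exists w; apply/is_geometric_stateP.
Qed.

Lemma geometric_state_is k (z : 'rV[R[i]]_(d * k).+1) : (0 < k)%N -> W z ->
  is_geometric_state s z (geometric_state s z).
Proof. by move=> k0 /(geometric_state_exists k0)[w wz]; exact: xgetI wz. Qed.

Lemma geometric_state_unique k (z : 'rV[R[i]]_(d * k).+1) w : (0 < k)%N -> W z ->
  is_geometric_state s z w -> geometric_state s z = w.
Proof.
move=> k0 zW; have := geometric_state_is k0 zW; have /WP[z1 zl] := zW.
move=> /(is_geometric_stateP _ z1)[ws wz] /(is_geometric_stateP _ z1)[ws' wz'].
exact: (fixing_state_unique d_gt0 k0 erel egen zl).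
Qed.

Lemma geometric_state_inj k (z z' : 'rV[R[i]]_(d * k).+1) : (0 < k)%N -> W z -> W z' ->
  geometric_state s z = geometric_state s z' -> z = z'.
Proof.
move=> k0 zW zW'; have := geometric_state_is k0 zW; have := geometric_state_is k0 zW'.
have /WP[z1 zl] := zW; have /WP[z1' zl'] := zW'.
move=> /(is_geometric_stateP _ z1')[ws' wz'] /(is_geometric_stateP _ z1)[ws wz] zz'.
apply/rowP => j; apply: (can_inj conjCK).
rewrite -((code_valuesP d_gt0 erel ws z1).2 wz) -((code_valuesP d_gt0 erel ws' z1').2 wz').
by rewrite zz'.
Qed.

(** * The vector [psi l z] and the state it determines *)

Section Psi.
Variables (k l : nat) (z : 'rV[R[i]]_(d * k).+1).
Hypotheses (k_gt0 : (0 < k)%N) (l_gt0 : (0 < l)%N) (kl : (k %| l)%N).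
Local Notation c := (z 0 ord_max).

Lemma code_sum_basis (j : nat) : (j <= d * l)%N ->
  code_sum e (basis R (d * l) j.+1) = code e d l j.
Proof.
move=> jl; rewrite /code_sum (bigD1 (inord j))//= big1 ?addr0.
  by rewrite /basis /= mxE !eqxx scale1r inordK.
by move=> i /negbTE ij; rewrite /basis mxE /= ij scale0r.
Qed.

Lemma code_sumD (x y : 'rV[R[i]]_(d * l).+1) :
  code_sum e (x + y) = code_sum e x + code_sum e y.
Proof. by rewrite -big_split; apply: eq_bigr => j _; rewrite mxE scalerDl. Qed.

Lemma code_sumZ a (x : 'rV[R[i]]_(d * l).+1) : code_sum e (a *: x) = a *: code_sum e x.
Proof. by rewrite scaler_sumr; apply: eq_bigr => j _; rewrite mxE scalerA. Qed.

Lemma code_sum0 : code_sum e (0 : 'rV[R[i]]_(d * l).+1) = 0.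
Proof. by rewrite /code_sum big1// => j _; rewrite mxE scale0r. Qed.

Let C := c *: e d ^+ k.

(* With T = B + C, where C = z_m s_n^k, the vector \hat z has
   \hat T = \sum_(r < l/k) C^r B + C^(l/k), so that
   \hat T - 1 = (\sum_(r < l/k) C^r) (T - 1). *)
Lemma code_sum_psi :
  code_sum e (psi l z) - 1 = (\sum_(r < l %/ k) C ^+ r) * (code_sum e z - 1).
Proof.
pose B := \sum_(i < d * k) z 0 (widen_ord (leqnSn _) i) *: code e d k i.
have TE : code_sum e z = B + C.
  by rewrite /code_sum big_ord_recr /= code_last.
have CX r : C ^+ r = c ^+ r *: e d ^+ (k * r) by rewrite exprZn exprM.
have -> : code_sum e (psi l z) = (\sum_(r < l %/ k) C ^+ r) * B + C ^+ (l %/ k).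
  rewrite /psi code_sumD code_sumZ code_sum_basis// code_last// coord_last CX.
  congr (_ + _ *: _); last first.
    by rewrite mulnC divnK.
  rewrite (big_morph (@code_sum _ _ _ _ _) code_sumD code_sum0) big_mkord mulr_suml.
  apply: eq_bigr => r _; rewrite (big_morph (@code_sum _ _ _ _ _) code_sumD code_sum0).
  rewrite big_add1 big_mkord mulr_sumr; apply: eq_bigr => i _.
  have [[a [b [ak bd iE]]]|iE] := code_indexP d_gt0 (ltnW (ltn_ord i)); last first.
    by have := ltn_ord i; rewrite iE ltnn.
  have rl : (k * r + a < l)%N.
    by have := ltn_ord r; have := divnK kl; nia.
  (* The factor [C^r] prefixes [s_n^(k r)], so the code word of order [k] with exponent [a] and
     letter [b] becomes the one of order [l] with exponent [k r + a] and the same letter. *)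
  have jE : (d * k * r + i = d * (k * r + a) + b)%N by rewrite iE; nia.
  rewrite addnS code_sumZ code_sum_basis /= jE; last by nia.
  rewrite code_lt// CX /= iE code_lt// exprD -scalerAr -scalerAl scalerA -mulrA.
  rewrite [in RHS]mulrC; congr (_ * z 0 _ *: _); apply: val_inj => /=.
  by rewrite inordK -?iE// ltnW// ltnS.
have geo : (\sum_(r < l %/ k) C ^+ r) * (1 - C) = 1 - C ^+ (l %/ k).
  elim: (l %/ k)%N => [|q IH]; first by rewrite big_ord0 mul0r subrr.
  by rewrite big_ord_recr /= mulrDl IH mulrBr mulr1 -exprSr addrA subrK.
have -> : code_sum e z - 1 = B - (1 - C) by rewrite TE opprB addrA.
by rewrite mulrBr geo opprB addrA.
Qed.

Lemma psi_last : psi l z 0 ord_max = c ^+ (l %/ k).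
Proof.
(* The double sum involves only 1-based indices up to [d * l], so it does not reach the last
   coordinate. *)
have last_basis j : (j < d * l)%N -> basis R (d * l) j.+1 0 ord_max = 0.
  move=> jl; rewrite mxE /= -val_eqE /= inordK ?gtn_eqF//; lia.
rewrite /psi mxE coord_last mxE [in X in _ + X]mxE eqxx /=.
rewrite (_ : ord_max == _) ?mulr1; last by apply/eqP/val_inj; rewrite /= inordK.
rewrite summxE big1_seq ?add0r// => r; rewrite mem_index_iota => /= rq.
rewrite summxE big1_seq// => i; rewrite mem_index_iota => /= ik.
have /andP[i1 idk] := ik; have j1 : (0 < d * k * r + i)%N by rewrite addn_gt0 i1 orbT.
rewrite mxE -(prednK j1) last_basis ?mulr0// prednK//.
by have := divnK kl; nia.
Qed.

Lemma psi_defect w : is_state w -> w (code_defect e z) = 0 ->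
  w (code_defect e (psi l z)) = 0.
Proof.
by move=> ws wz; rewrite /code_defect code_sum_psi mulrA (state_null ws wz).
Qed.

(** The norm is read off from the state [w] by [z]. For the code sum [T'] of [psi l z],
    [star T' * T'] is the squared norm, and since [w] absorbs [T'], its value is
    [w (star T') = 1]. *)
Lemma psi_W : W z -> W (psi l z).
Proof.
move=> zW; have := geometric_state_is k_gt0 zW; have /WP[z1 zl] := zW.
move=> /(is_geometric_stateP _ z1)[ws /(psi_defect ws) wz]; apply/WP; split.
  have := state_star ws (code_sum e (psi l z)).
  have := fixed_mul ws wz (star (code_sum e (psi l z))).
  rewrite code_sum_normsq// stateZ// (state1 ws) mulr1 => ->.
  by have := fixed_mul ws wz 1; rewrite mul1r (state1 ws) => -> ->; rewrite rmorph1.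
by rewrite psi_last normrX exprn_ilt1// -lt0n divn_gt0// dvdn_leq.
Qed.

Lemma geometric_state_psi : W z -> geometric_state s (psi l z) = geometric_state s z.
Proof.
move=> zW; apply: geometric_state_unique => //; first exact: psi_W.
have := geometric_state_is k_gt0 zW; have /WP[z1 zl] := zW; have /WP[z1' _] := psi_W zW.
move=> /(is_geometric_stateP _ z1)[ws wz].
by apply/is_geometric_stateP => //; split=> //; exact: psi_defect.
Qed.

End Psi.
End GeometricStates.

(** * The two inductive systems and their isomorphism *)

Lemma directed_divides : directed_set posnat divides.
Proof.
split; first by exists 1%N.
- by move=> k _; exact: dvdnn.
- by move=> j k l _ _ _; exact: dvdn_trans.
- move=> k l k0 l0; exists (k * l)%N; split; first by rewrite /posnat/= muln_gt0 k0.
    exact: dvdn_mulr.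
  exact: dvdn_mull.
Qed.

Theorem theorem1p13 (R : realType) (n : nat) (hn : (2 <= n)%N)
    (On : cstarAlgType R) (s : n.-tuple On) (hOn : is_cuntz_algebra s) :
  [/\ (forall k l : nat, posnat k -> posnat l -> divides k l ->
         Sset s k `<=` Sset s l) /\
      inductive_system posnat divides (fun k : nat => Sset s k)
        (fun (l k : nat) (w : On -> R[i]) => w),
      inductive_system posnat divides (fun k : nat => @W R n k)
        (fun l k : nat => @psi R n l k)
    & inductive_isomorphism posnat divides
        (fun k : nat => @W R n k) (fun l k : nat => @psi R n l k)
        (fun k : nat => Sset s k) (fun (l k : nat) (w : On -> R[i]) => w)
        (fun k : nat => @geometric_state R On n s k)].
Proof.
have sub k l : posnat k -> posnat l -> divides k l -> Sset s k `<=` Sset s l.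
  move=> k0 l0 kl _ [z zW <-]; exists (psi l z); first exact: (psi_W hn hOn).
  exact: (geometric_state_psi hn hOn).
split; first split=> //.
- by split=> //; exact: directed_divides.
- split; first exact: directed_divides.
  + by move=> k l k0 l0 kl z zW; exact: (psi_W hn hOn).
  (* Both vectors determine the same state, so injectivity of the parametrization replaces a
     computation with coordinates. The identity law is obtained in the same way. *)
  + move=> k l g k0 l0 g0 kl lg z zW.
    have kg := dvdn_trans kl lg; have zW' := psi_W hn hOn k0 l0 kl zW.
    apply: (geometric_state_inj hn hOn g0); [exact: (psi_W hn hOn)..|].
    by rewrite !(geometric_state_psi hn hOn).
  + move=> k k0 z zW; apply: (geometric_state_inj hn hOn k0) => //.
      by apply: (psi_W hn hOn) => //; exact: dvdnn.
    by rewrite (geometric_state_psi hn hOn)//; exact: dvdnn.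
- split=> [k k0|k l k0 l0 kl z zW]; last exact: (geometric_state_psi hn hOn).
  split.
  + by move=> z zW; exists z.
  + move=> z z' /set_mem zW /set_mem zW'; exact: (geometric_state_inj hn hOn).
  + by move=> _ [z zW <-]; exists z.
Qed.
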